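(* Let $n,k,s$ be positive integers with $n>s(s+2)k$, and let $\mathcal F\subset\binom{[n]}{k}$ be a family such that $|F_0\cup F_1\cup\ldots\cup F_s|\le k+s(k-1)$ for any $F_0,\ldots,F_s\in\mathcal F$. Then $|\mathcal F|\le\binom{n-1}{k-1}$.
   Context: $[n]=\{1,\ldots,n\}$ and $\binom{[n]}{k}$ denotes the collection of all $k$-element subsets of $[n]$. The sets $F_0,\ldots,F_s$ are arbitrary members of $\mathcal F$ (not necessarily distinct). *)

(* Defs.v *)
From mathcomp Require Export all_boot.
Set Implicit Arguments.
Unset Strict Implicit.
Unset Printing Implicit Defensive.

(* Main.v *)
Require Import Defs.
From mathcomp Require Import all_boot.
From mathcomp Require Import fingroup perm.
From mathcomp Require Import zify.

(** Shifting (replacing [j] by [i < j] whenever possible) preserves sizes and the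
    union condition, so [F] may be assumed shifted.  Let [a < b] be the two
    smallest points, [W] their complement, and among the [k-1]-subsets [B] of [W]
    let [X] collect those with [a |: B] in [F] and [Y] those with [b |: B] in [F].
    Shiftedness gives that [Y] is contained in [X] and that the shadow of the
    members of [F] inside [W] is contained in [Y]; since [F] has no [s+1]
    disjoint members, Katona's shadow inequality bounds the number of the latter
    by [s |Y|].  A member of [Y] and [s] members of [X] are never pairwise
    disjoint, as adding [a] and [b] would violate the union condition.  Hence
    among [s(s+2)] disjoint [k-1]-subsets of [W], if some lies in [Y] then at most
    [s] lie in [X], and averaging over the permutations of [W] yields
    [(s+1)|Y| + |X| <= C(n-2, k-1)].  At most [C(n-2, k-2)] members of [F] contain
    both [a] and [b], and Pascal's rule concludes. *)

Set Implicit Arguments.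
Unset Strict Implicit.
Unset Printing Implicit Defensive.

(** * Set families and the shift operation *)

(** Two cutoffs [q] matter: [(s.+1 * k).+2] is the hypothesis of the theorem for sets of size
    [k.+1], while [s.+1 * k] for [k]-sets forbids [s.+1] pairwise disjoint members. *)
Definition unions_lt (T : finType) (m q : nat) (F : {set {set T}}) :=
  forall G : 'I_m -> {set T},
    (forall i, G i \in F) -> #|\bigcup_(i < m) G i| < q.

Definition shadow (T : finType) (F : {set {set T}}) : {set {set T}} :=
  [set A :\ x | A in F, x in A].

Definition link (T : finType) (x : T) (F : {set {set T}}) : {set {set T}} :=
  [set A :\ x | A in [set A in F | x \in A]].

Definition replace (T : finType) (i j : T) (A : {set T}) := i |: (A :\ j).

(** [V] is explicit because the shadow inequality deletes points from it and is later applied to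
    [W]. *)
Definition shifted_on n (V : {set 'I_n}) (F : {set {set 'I_n}}) :=
  forall i j A, i \in V -> j \in V -> i < j ->
    A \in F -> j \in A -> i \notin A -> replace i j A \in F.

(** A set stays put when its replacement already lies in [F]; this makes the map injective on
    [F]. *)
Definition shift (T : finType) (F : {set {set T}}) (i j : T) (A : {set T}) :=
  if [&& j \in A, i \notin A & replace i j A \notin F]
  then replace i j A else A.

Lemma card_replace (T : finType) (i j : T) (A : {set T}) :
  j \in A -> i \notin A -> #|replace i j A| = #|A|.
Proof.
move=> jA iA; rewrite /replace cardsU1 !inE (negPf iA) andbF /=.
by rewrite [RHS](cardsD1 j) jA.
Qed.

Lemma replaceK (T : finType) (i j : T) (A : {set T}) :
  j \in A -> i \notin A -> replace j i (replace i j A) = A.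
Proof.
move=> jA iA; apply/setP => x; rewrite !inE.
case: (eqVneq x j) => [->|_] //=; case: (eqVneq x i) => [->|_] //=.
by rewrite (negPf iA).
Qed.

Section Shift.
Variables (T : finType) (F : {set {set T}}) (i j : T).

Lemma card_shift A : #|shift F i j A| = #|A|.
Proof. by rewrite /shift; case: ifP => // /and3P[jA iA _]; rewrite card_replace. Qed.

Lemma shift_inj : {in F &, injective (shift F i j)}.
Proof.
move=> A B AF BF; rewrite /shift.
case: ifP => [/and3P[jA iA nA]|_]; case: ifP => [/and3P[jB iB nB]|_] //.
- by move=> e; rewrite -(replaceK jA iA) e replaceK.
- by move=> e; rewrite e BF in nA.
- by move=> e; rewrite -e AF in nB.
Qed.

Lemma card_shift_family : #|shift F i j @: F| = #|F|.
Proof. exact: card_in_imset shift_inj. Qed.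

Lemma unions_lt_shift m q :
  i != j -> unions_lt m q F -> unions_lt m q (shift F i j @: F).
Proof.
move=> neq_ij FU G GF.
have /fin_all_exists2[H HF GH] : forall l, exists2 A, A \in F & G l = shift F i j A.
  by move=> l; have /imsetP[A AF ->] := GF l; exists A.
pose moved (A : {set T}) := [&& j \in A, i \notin A & replace i j A \notin F].
have GHn l : ~~ moved (H l) -> G l = H l.
  by rewrite GH /shift -/(moved _) => /negPf->.
have GHm l : moved (H l) -> G l = replace i j (H l).
  by rewrite GH /shift -/(moved _) => ->.
have [/existsP[a ma]|nomove] := boolP [exists l, moved (H l)]; last first.
  rewrite (eq_bigr H); first exact: FU.
  move=> l _; apply: GHn; apply: contra nomove => ml; by apply/existsP; exists l.
have /and3P[jHa iHa _] := ma.
(* the preimages already work unless [j] lies in the union and [i] only in moved sets *)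
have [/existsP[b /andP[jGb iUH]]|good] :=
  boolP [exists b, (j \in G b) && (i \notin \bigcup_l H l)].
- have nmb : ~~ moved (H b).
    apply/negP => mb; move: jGb; rewrite (GHm _ mb) !inE eqxx /= orbF.
    by rewrite eq_sym (negPf neq_ij).
  have iHb : i \notin H b by apply: contra iUH => ?; apply/bigcupP; exists b.
  have jHb : j \in H b by rewrite -(GHn _ nmb).
  (* As [H b] is unmoved although it contains [j] and misses [i], its replacement must lie in [F].
     Exchanging the two brings in [i], while [j] is still covered by the moved set [H a]. *)
  have rF : replace i j (H b) \in F.
    by move: nmb; rewrite /moved jHb iHb /= negbK.
  pose H' l := if l == b then replace i j (H b) else H l.
  have H'F l : H' l \in F by rewrite /H'; case: ifP.
  apply: leq_ltn_trans (FU H' H'F); apply: subset_leq_card.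
  apply/subsetP => x /bigcupP[l _ xG]; apply/bigcupP.
  have [->|xi] := eqVneq x i; first by exists b; rewrite // /H' eqxx !inE eqxx.
  have [->|xj] := eqVneq x j.
    exists a; rewrite // /H'; case: eqP => [ab|_] //.
    by rewrite -ab ma in nmb.
  exists l => //; rewrite /H'; case: eqP => [lb|_].
    by move: xG; rewrite lb (GHn _ nmb) !inE xj => ->; rewrite orbT.
  move: xG; case: (boolP (moved (H l))) => ml; last by rewrite GHn.
  by rewrite GHm // !inE (negPf xi) xj.
- apply: leq_ltn_trans (FU H HF).
  set UG := \bigcup_l G l; set UH := \bigcup_l H l.
  have sub x : x != i -> x \in UG -> x \in UH.
    move=> xi /bigcupP[l _ xG]; apply/bigcupP.
    case: (boolP (moved (H l))) => ml; last by exists l; rewrite // -GHn.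
    exists l => //; move: xG; rewrite GHm // !inE (negPf xi) /=.
    by case/andP.
  have jUH : j \in UH by apply/bigcupP; exists a.
  case: (boolP (i \in UH)) => iUH.
    apply: subset_leq_card; apply/subsetP => x xG.
    by have [->|xi] := eqVneq x i; last exact: sub.
  (* Here [i] is new in the union but [j] is lost, so the size does not grow. *)
  have jUG : j \notin UG.
    apply: contra good => /bigcupP[b _ jGb]; apply/existsP; exists b.
    by rewrite jGb.
  have iUG : i \in UG by apply/bigcupP; exists a; rewrite // GHm // !inE eqxx.
  rewrite (cardsD1 i) iUG [in leqRHS](cardsD1 j) jUH leq_add2l.
  apply: subset_leq_card; apply/subsetP => x; rewrite !inE => /andP[xi xG].
  by rewrite (sub x) // andbT; apply: contraNneq jUG => <-.
Qed.

End Shift.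

(** * Reduction to shifted families *)

Definition weight n (F : {set {set 'I_n}}) := \sum_(A in F) \sum_(x in A) (x : nat).

Lemma weight_shift n (F : {set {set 'I_n}}) (i j : 'I_n) (A : {set 'I_n}) :
  i < j -> A \in F -> j \in A -> i \notin A -> replace i j A \notin F ->
  weight (shift F i j @: F) < weight F.
Proof.
move=> ij AF jA iA nF; rewrite /weight big_imset /=; last exact: shift_inj.
have E (B : {set _}) : j \in B -> i \notin B ->
    \sum_(x in replace i j B) (x : nat) < \sum_(x in B) (x : nat).
  move=> jB iB; rewrite big_setU1 /=; last by rewrite !inE (negPf iB) andbF.
  by rewrite [ltnRHS](big_setD1 j) //= ltn_add2r.
rewrite (bigD1 A) //= [ltnRHS](bigD1 A) //= -addSn; apply: leq_add.
  by rewrite /shift jA iA nF /= E.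
apply: leq_sum => B _; rewrite /shift; case: ifP => // /and3P[jB iB _].
by rewrite ltnW // E.
Qed.

(** Strong induction on [weight]: a triple witnessing that [F] is not shifted yields a shift that
    strictly lowers it. *)
Lemma shifting_ind n (P : {set {set 'I_n}} -> Prop) :
  (forall F, shifted_on [set: 'I_n] F -> P F) ->
  (forall F (i j : 'I_n), i < j -> P (shift F i j @: F) -> P F) ->
  forall F, P F.
Proof.
move=> Pshifted Pshift F; have [m] := ubnP (weight F).
elim: m F => // m IH F ltF.
pose bad (p : 'I_n * 'I_n * {set 'I_n}) :=
  [&& p.1.1 < p.1.2, p.2 \in F, p.1.2 \in p.2, p.1.1 \notin p.2
    & replace p.1.1 p.1.2 p.2 \notin F].
have [/existsP[[[i j] A] /and5P[/= ij AF jA iA nF]]|nobad] := boolP [exists p, bad p].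
  apply: (Pshift F i j ij); apply: IH.
  exact: leq_trans (weight_shift ij AF jA iA nF) _.
apply: Pshifted => i j A _ _ ij AF jA iA.
apply: contraNT nobad => nF; apply/existsP; exists (i, j, A).
by rewrite /bad /= ij AF jA iA.
Qed.

(** * Katona's shadow inequality for shifted families *)

Lemma leq_card_bigcup (T : finType) (k m : nat) (G : 'I_m -> {set T}) :
  (forall i, #|G i| = k) -> #|\bigcup_(i < m) G i| <= m * k.
Proof.
move=> cG; apply: leq_trans (_ : \sum_(i < m) #|G i| <= _).
  elim/big_rec2: _ => [|i x A _ le]; first by rewrite cards0.
  by rewrite (leq_trans (leq_card_setU _ _)) // leq_add2l.
by rewrite (eq_bigr (fun=> k)) // sum_nat_const card_ord.
Qed.

(** Counts pairs of a member [A] and a point [x] of [A]. Each [A] gives [k.+1] pairs; a pair is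
    determined by [x] and [A :\ x], and a given shadow set leaves [#|V| - k] choices of [x] outside
    it. *)
Lemma shadow_double_count (T : finType) (V : {set T}) (k : nat) (F : {set {set T}}) :
  (forall A, A \in F -> A \subset V) -> (forall A, A \in F -> #|A| = k.+1) ->
  #|F| * k.+1 <= #|shadow F| * (#|V| - k).
Proof.
move=> FV Fk.
have -> : #|F| * k.+1 = \sum_(x in V) #|[set A in F | x \in A]|.
  rewrite -sum_nat_const (eq_bigr (fun A : {set T} => \sum_(x in V) (x \in A : nat))).
    rewrite exchange_big /=; apply: eq_bigr => x _.
    by rewrite -big_mkcondr /= sum1dep_card.
  move=> A AF; rewrite -(Fk _ AF) -big_mkcondr /= sum1dep_card.
  by apply: eq_card => x; rewrite inE andbC; case: (boolP (x \in A)) => // /(subsetP (FV _ AF)) ->.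
have -> : #|shadow F| * (#|V| - k) = \sum_(x in V) #|[set B in shadow F | x \notin B]|.
  rewrite -sum_nat_const.
  rewrite (eq_bigr (fun B : {set T} => \sum_(x in V) (x \notin B : nat))).
    rewrite exchange_big /=; apply: eq_bigr => x _.
    by rewrite -big_mkcondr /= sum1dep_card.
  move=> _ /imset2P[A x AF xA ->]; rewrite -big_mkcondr /= sum1dep_card.
  have sB : A :\ x \subset V by apply: subset_trans (FV _ AF); apply: subsetDl.
  have cB : #|A :\ x| = k by have := cardsD1 x A; rewrite xA Fk //; lia.
  have := cardsD V (A :\ x); rewrite (setIidPr sB) cB => <-.
  by apply: eq_card => y; rewrite !inE andbC.
apply: leq_sum => x _.
rewrite -(card_in_imset (f := fun A => A :\ x)).
  apply: subset_leq_card; apply/subsetP => _ /imsetP[A + ->].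
  rewrite !inE eqxx /= andbT => /andP[AF xA].
  by apply/imset2P; exists A x.
move=> A B; rewrite !inE => /andP[_ xA] /andP[_ xB] e.
by rewrite -(setD1K xA) e setD1K.
Qed.

(** Members avoiding [x] have shadows avoiding [x]; shadow sets of the link, with [x] added back,
    are shadow sets of [F] containing [x]. *)
Lemma card_shadow_link (T : finType) (x : T) (F : {set {set T}}) :
  #|shadow [set A in F | x \notin A]|
    + #|shadow (link x F)| <= #|shadow F|.
Proof.
set F0 := [set A in F | x \notin A]; set F1 := link x F.
have F1P B : B \in F1 -> x \notin B /\ x |: B \in F.
  case/imsetP => A; rewrite inE => /andP[AF xA] ->.
  by rewrite setD1K // !inE eqxx.
have sF1 B : B \in shadow F1 -> x \notin B.
  by case/imset2P => A y /F1P[xA _] _ ->; rewrite inE (negPf xA) andbF.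
have <- : #|[set x |: B | B in shadow F1]| = #|shadow F1|.
  apply: card_in_imset => A B /sF1 xA /sF1 xB e.
  by rewrite -(setU1K xA) e setU1K.
rewrite -cardsUI; set I := _ :&: _; have -> : I = set0.
  apply/setP => B; rewrite !inE; apply/negP => /andP[/imset2P[A y]].
  rewrite inE => /andP[_ xA] _ -> /imsetP[C _ e].
  by move/setP/(_ x): e; rewrite !inE eqxx (negPf xA) andbF.
rewrite cards0 addn0; apply: subset_leq_card; rewrite subUset; apply/andP; split.
  apply/subsetP => _ /imset2P[A y + yA ->]; rewrite inE => /andP[AF _].
  by apply/imset2P; exists A y.
apply/subsetP => _ /imsetP[_ /imset2P[A y /F1P[xA AF] yA ->] ->].
apply/imset2P; exists (x |: A) y; rewrite // ?inE ?yA ?orbT //.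
apply/setP => z; rewrite !inE; case: (eqVneq z x) => [->|] //=.
by rewrite andbT; symmetry; apply: contraNneq xA => ->.
Qed.

Lemma card_link (T : finType) (x : T) (F : {set {set T}}) :
  #|F| = #|[set A in F | x \notin A]| + #|link x F|.
Proof.
rewrite card_in_imset => [|A B]; last first.
  rewrite !inE => /andP[_ xA] /andP[_ xB] e.
  by rewrite -(setD1K xA) e setD1K.
rewrite -(cardsID [set A : {set T} | x \in A] F) addnC; congr (_ + _); apply: eq_card => A.
  by rewrite !inE andbC.
by rewrite !inE.
Qed.

(* If the sets through the largest point [x] had [s.+1] disjoint links, shifting
   [x] to distinct unused points of [V] would give [s.+1] disjoint members. *)
Lemma unions_lt_link n (V : {set 'I_n}) (x : 'I_n) (s k : nat) (F : {set {set 'I_n}}) :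
  x \in V -> {in V, forall y : 'I_n, y <= x} -> s.+1 * k.+1 <= #|V| ->
  (forall A, A \in F -> #|A| = k.+1) -> shifted_on V F ->
  unions_lt s.+1 (s.+1 * k.+1) F ->
  unions_lt s.+1 (s.+1 * k) (link x F).
Proof.
move=> xV maxx leV Fk Fsh FU G GF.
have GP i : x \notin G i /\ x |: G i \in F.
  have /imsetP[A + ->] := GF i; rewrite inE => /andP[AF xA].
  by rewrite setD1K // !inE eqxx.
have Gk i : #|G i| = k.
  by have [xG /Fk] := GP i; rewrite cardsU1 xG add1n => -[].
have leU := leq_card_bigcup Gk; rewrite ltnNge; apply/negP => geU.
set U := \bigcup_i G i in leU geU; pose R := V :\: U.
have leR : s.+1 <= #|R|.
  have leI : #|V :&: U| <= #|U| := subset_leq_card (subsetIr V U).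
  by rewrite cardsD; move: leV; rewrite mulnS; lia.
pose h (i : 'I_s.+1) := enum_val (widen_ord leR i).
have hR i : h i \in R by apply: enum_valP.
have hinj : injective h by move=> i j /enum_val_inj/(congr1 val) /= /val_inj.
pose H i := h i |: G i.
have hG i : h i \notin G i.
  have := hR i; rewrite inE => /andP[+ _]; apply: contra => hi.
  by apply/bigcupP; exists i.
have HF i : H i \in F.
  have [xG GxF] := GP i; have := hR i; rewrite inE => /andP[_ hV].
  have [hx|hx] := eqVneq (h i) x; first by rewrite /H hx.
  have -> : H i = replace (h i) x (x |: G i) by rewrite /replace setU1K.
  apply: Fsh; rewrite ?inE ?eqxx ?(negPf hx) ?hG //.
  by rewrite ltn_neqAle maxx // andbT.
have := FU H HF; rewrite ltnNge => /negP; apply.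
(* By [geU], the points of [U] and the [s.+1] new ones number at least [s.+1 * k.+1]. *)
have sub : U :|: [set h i | i : 'I_s.+1] \subset \bigcup_i H i.
  rewrite subUset; apply/andP; split; apply/subsetP.
    by move=> y /bigcupP[i _ yi]; apply/bigcupP; exists i; rewrite // !inE yi orbT.
  by move=> _ /imsetP[i _ ->]; apply/bigcupP; exists i; rewrite // !inE eqxx.
apply: leq_trans (subset_leq_card sub).
have dis : U :&: [set h i | i : 'I_s.+1] = set0.
  apply/setP => y; rewrite !inE; apply/negP => /andP[yU /imsetP[i _ e]].
  by have := hR i; rewrite inE -e yU.
by rewrite cardsU dis cards0 subn0 card_imset // card_ord mulnS addnC leq_add2r.
Qed.

(** Induction on [#|V|]. A small ground set is settled by double counting; otherwise the largest
    point splits [F] into the members avoiding it and its link, which both inherit the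
    hypotheses. *)
Lemma leq_card_shadow n (V : {set 'I_n}) (s k : nat) (F : {set {set 'I_n}}) :
  (forall A, A \in F -> A \subset V) -> (forall A, A \in F -> #|A| = k) ->
  shifted_on V F -> unions_lt s.+1 (s.+1 * k) F -> #|F| <= s * #|shadow F|.
Proof.
have [m] := ubnP #|V|; elim: m V k F => // m IH V [|k] F ltV FV Fk Fsh FU.
  (* For sets of size [0] the cutoff is [0], and no cardinality lies below it. *)
  have -> : F = set0.
    apply/setP => A; rewrite inE; apply/negP => AF.
    by have := FU (fun=> A) (fun=> AF); rewrite muln0.
  by rewrite cards0.
have [small|large] := ltnP #|V| (s.+1 * k.+1).
  rewrite -(leq_pmul2r (ltn0Sn k)).
  apply: leq_trans (shadow_double_count FV Fk) _.
  (* What remains is [#|V| - k <= s * k.+1], a rearrangement of [#|V| < s.+1 * k.+1]. *)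
  rewrite [leqRHS]mulnAC [leqRHS]mulnC leq_mul2l; apply/orP; right.
  by move: small; rewrite mulSn; lia.
have [x0 x0V] : exists x, x \in V by apply/set0Pn; rewrite -card_gt0; lia.
pose x := [arg max_(y > x0 in V) (y : nat)].
have [xV maxx] : x \in V /\ {in V, forall y : 'I_n, y <= x}.
  by rewrite /x; case: arg_maxnP.
have ltV' : #|V :\ x| < m by move: ltV; rewrite (cardsD1 x V) xV.
rewrite (card_link x F).
apply: leq_trans (leq_mul (leqnn s) (card_shadow_link x F)); rewrite mulnDr.
apply: leq_add.
- apply: (IH (V :\ x) k.+1) => //.
  + by move=> A; rewrite inE => /andP[AF xA]; rewrite subsetD1 FV.
  + by move=> A; rewrite inE => /andP[/Fk].
  + move=> i j A; rewrite !inE => /andP[ix iV] /andP[jx jV] ij /andP[AF xA] jA iA.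
    by rewrite Fsh //= (negPf xA) andbF orbF eq_sym.
  + by move=> G GF; apply: FU => i; have := GF i; rewrite inE => /andP[].
- apply: (IH (V :\ x) k) => //.
  + move=> _ /imsetP[A + ->]; rewrite inE => /andP[/FV AV _].
    exact: setSD.
  + move=> _ /imsetP[A + ->]; rewrite inE => /andP[/Fk cA xA].
    by have := cardsD1 x A; rewrite xA cA add1n => -[].
  + move=> i j B; rewrite !inE => /andP[ix iV] /andP[jx jV] ij /imsetP[A + ->].
    rewrite !inE ix jx /= => /andP[AF xA] jA iA; apply/imsetP; exists (replace i j A).
      by rewrite !inE Fsh //= (eq_sym x j) jx xA orbT.
    apply/setP => y; rewrite !inE.
    case: (eqVneq y i) => [->|_] //=; first by rewrite ix.
    by rewrite andbCA.
  + exact: (unions_lt_link (V := V)).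
Qed.

(** * Averaging over the permutations of a set *)

Lemma exists_disjoint_subsets (T : finType) (W : {set T}) (t l : nat) :
  t * l <= #|W| ->
  exists P : nat -> {set T},
    (forall i, i < t -> P i \subset W /\ #|P i| = l) /\
    (forall i j, i < j < t -> [disjoint P i & P j]).
Proof.
elim: t W => [|t IH] W; first by move=> _; exists (fun=> set0); split => [//|i j]; lia.
rewrite mulSn => leW.
have [A AW cA] : exists2 A : {set T}, A \subset W & #|A| = l.
  have : 0 < #|[set A : {set T} | A \subset W & #|A| == l]|.
    by rewrite cards_draws bin_gt0; lia.
  by case/card_gt0P => A; rewrite inE => /andP[? /eqP ?]; exists A.
have [|P [Psub Pdis]] := IH (W :\: A).
  by have := cardsD W A; rewrite (setIidPr AW) cA; lia.
exists (fun i => if i is i'.+1 then P i' else A); split.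
  case=> [//|i lt_it]; have [PW cP] := Psub i lt_it; split=> //.
  exact: subset_trans PW (subsetDl _ _).
case=> [|i] [|j] //= ij; last exact: Pdis.
have [PW _] := Psub j ij; rewrite disjoint_sym.
by apply: disjointWl PW _; rewrite -setI_eq0 setIDAC setDIl setDv setI0.
Qed.

(* [perm_on W] acts transitively on the [l]-subsets of [W], transpositions suffice. *)
Lemma card_perm_on_imset (T : finType) (W P A B : {set T}) :
  A \subset W -> B \subset W -> #|A| = #|B| ->
  #|[set u : {perm T} | perm_on W u & u @: P == A]|
    = #|[set u : {perm T} | perm_on W u & u @: P == B]|.
Proof.
have [m] := ubnP #|A :\: B|; elim: m A => // m IH A ltm AW BW eqAB.
have [AB|] := boolP (A \subset B).
  by have -> : A = B by apply/eqP; rewrite eqEcard AB eqAB /=.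
case/subsetPn => x xA xB.
have [y yB yA] : exists2 y, y \in B & y \notin A.
  apply/subsetPn; apply/negP => BA; move: xB.
  have -> : B = A by apply/eqP; rewrite eqEcard BA eqAB /=.
  by rewrite xA.
have xy : x != y by apply: contraNneq yA => <-.
have tW : perm_on W (tperm x y).
  apply/subsetP => z; rewrite inE; case: tpermP => [->|->|]; rewrite ?eqxx // => _.
    exact: (subsetP AW).
  exact: (subsetP BW).
have tA : tperm x y @: A = replace y x A.
  apply/setP => z; rewrite -[z in LHS](tpermK x y) mem_imset; last exact: perm_inj.
  rewrite !inE; case: tpermP => [->|->|/eqP zx /eqP zy].
  - by rewrite eqxx (negPf yA) (negPf xy).
  - by rewrite eqxx xA.
  - by rewrite zx (negPf zy).
rewrite -(IH (replace y x A)) //.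
(* Composition with the transposition is an involution matching the permutations that send [P] to
   [A] with those that send it to [replace y x A]. *)
- pose tau (u : {perm T}) := (u * tperm x y)%g.
  have tauK : involutive tau by move=> u; rewrite /tau -mulgA tperm2 mulg1.
  rewrite -(card_imset _ (inv_inj tauK)); apply: eq_card => v.
  rewrite -[v]tauK mem_imset; last exact: inv_inj.
  set u := tau v; rewrite !inE.
  have -> : perm_on W (tau u) = perm_on W u.
    apply/idP/idP => h; last exact: perm_onM.
    by rewrite -[u]tauK; apply: perm_onM.
  have -> : tau u @: P = tperm x y @: (u @: P).
    by rewrite -imset_comp; apply: eq_imset => z; rewrite permM.
  by rewrite -tA (inj_eq (imset_inj (@perm_inj _ _))).
- move: ltm; rewrite (cardsD1 x (A :\: B)) !inE xA xB add1n ltnS.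
  apply: leq_trans; rewrite ltnS; apply: subset_leq_card; apply/subsetP => z; rewrite !inE => /andP[].
  by case: (eqVneq z y) => [->|_ ->]; first by rewrite yB.
- apply/subsetP => z; rewrite !inE; case: (eqVneq z y) => [-> _|_ /andP[_]].
    exact: (subsetP BW).
  exact: (subsetP AW).
- by rewrite card_replace.
Qed.

Lemma sum_perm_on_fibers (T : finType) (W P : {set T}) (X : {set {set T}}) :
  \sum_(u : {perm T} | perm_on W u) (u @: P \in X : nat)
    = \sum_(A in X) #|[set u : {perm T} | perm_on W u & u @: P == A]|.
Proof.
transitivity (\sum_(u : {perm T} | perm_on W u) \sum_(A in X) (u @: P == A : nat)).
  apply: eq_bigr => u _; case: (boolP (_ \in X)) => uX.
    rewrite (bigD1 (u @: P)) //= eqxx big1 // => A /andP[_].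
    by rewrite eq_sym => /negPf->.
  by rewrite big1 // => A AX; case: eqP => // e; rewrite e AX in uX.
rewrite exchange_big /=; apply: eq_bigr => A _.
by rewrite -big_mkcondr /= sum1dep_card; apply: eq_card => u; rewrite !inE.
Qed.

(** Under a uniformly random permutation of [W] the image of [P] is uniform among the [#|P|]-subsets
    of [W]; the probability of landing in [X] is stated with denominators cleared. *)
Lemma sum_perm_on_imset (T : finType) (W P : {set T}) (X : {set {set T}}) :
  P \subset W -> (forall A, A \in X -> A \subset W /\ #|A| = #|P|) ->
  (\sum_(u : {perm T} | perm_on W u) (u @: P \in X : nat)) * 'C(#|W|, #|P|)
    = #|X| * #|[set u : {perm T} | perm_on W u]|.
Proof.
move=> PW XP; pose c := #|[set u : {perm T} | perm_on W u & u @: P == P]|.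
have E (Z : {set {set T}}) : (forall A, A \in Z -> A \subset W /\ #|A| = #|P|) ->
    \sum_(u : {perm T} | perm_on W u) (u @: P \in Z : nat) = #|Z| * c.
  move=> ZP; rewrite sum_perm_on_fibers -sum_nat_const; apply: eq_bigr => A /ZP[AW cA].
  exact: card_perm_on_imset.
(* The constant [c] is found by applying [E] to all [#|P|]-subsets of [W], one of which every
   permutation of [W] hits. *)
rewrite E // -mulnA -cards_draws; congr (_ * _); rewrite mulnC -E; last first.
  by move=> A; rewrite inE => /andP[AW /eqP].
rewrite -sum1dep_card; apply: eq_bigr => u uW; rewrite inE.
rewrite card_imset ?eqxx ?andbT; last exact: perm_inj.
suff -> : u @: P \subset W by [].
apply/subsetP => _ /imsetP[z zP ->]; rewrite perm_closed //.
exact: (subsetP PW).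
Qed.

Lemma card_bigcup_disjoint (I T : finType) (J : {set I}) (Q : I -> {set T}) (l : nat) :
  {in J, forall i, #|Q i| = l} -> {in J &, forall i j, i != j -> [disjoint Q i & Q j]} ->
  #|\bigcup_(i in J) Q i| = #|J| * l.
Proof.
have [m] := ubnP #|J|; elim: m J => // m IH J ltm cQ dQ.
have [->|[i iJ]] := set_0Vmem J; first by rewrite big_set0 !cards0.
rewrite (big_setD1 i) //= cardsU.
have -> : Q i :&: \bigcup_(j in J :\ i) Q j = set0.
  apply/setP => x; rewrite !inE; apply/negP => /andP[xi /bigcupP[j]].
  rewrite !inE => /andP[ji jJ] xj.
  have := dQ _ _ iJ jJ; rewrite eq_sym ji => /(_ isT) /disjointFr /(_ xi).
  by rewrite xj.
rewrite cards0 subn0 cQ // IH.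
- by rewrite (cardsD1 i J) iJ mulSn.
- by move: ltm; rewrite (cardsD1 i J) iJ.
- by move=> j /setD1P[_ /cQ].
- by move=> j j' /setD1P[_ jJ] /setD1P[_ j'J]; apply: dQ.
Qed.

Lemma cross_dependent_bound (T : finType) (W : {set T}) (s l : nat)
    (X Y : {set {set T}}) :
  s * (s + 2) * l <= #|W| -> 0 < s -> Y \subset X ->
  (forall A, A \in X -> A \subset W /\ #|A| = l) ->
  (forall A (G : 'I_s -> {set T}), A \in Y -> (forall i, G i \in X) ->
     #|A :|: \bigcup_(i < s) G i| < s.+1 * l) ->
  s.+1 * #|Y| + #|X| <= 'C(#|W|, l).
Proof.
set t := s * (s + 2) => leW s_gt0 YX XP cross.
have [P [Psub Pdis]] := exists_disjoint_subsets leW.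
pose hits (u : {perm T}) (Z : {set {set T}}) := \sum_(i < t) (u @: P i \in Z : nat).
have local (u : {perm T}) : perm_on W u -> s.+1 * hits u Y + hits u X <= t.
  move=> uW; pose hitset (Z : {set {set T}}) := [set i : 'I_t | u @: P i \in Z].
  have hE Z : hits u Z = #|hitset Z| by rewrite /hits -big_mkcond /= sum1dep_card.
  have sYX : hitset Y \subset hitset X.
    by apply/subsetP => i; rewrite !inE => /(subsetP YX).
  (* With no image in [Y], the trivial bound [t] on the images in [X] suffices. *)
  rewrite !hE; have [->|[i0 i0Y]] := set_0Vmem (hitset Y).
    by rewrite cards0 muln0 -[leqRHS]card_ord max_card.
  have leX : #|hitset X| <= s.
    rewrite leqNgt; apply/negP => gtX.
    have leR : s <= #|hitset X :\ i0|.
      by move: gtX; rewrite (cardsD1 i0) (subsetP sYX _ i0Y).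
    pose h (j : 'I_s) := enum_val (widen_ord leR j).
    have hX j : h j \in hitset X :\ i0 by apply: enum_valP.
    have hinj : injective h by move=> i j /enum_val_inj/(congr1 val) /= /val_inj.
    have i0Y' : u @: P i0 \in Y by move: i0Y; rewrite inE.
    have hX' j : u @: P (h j) \in X by have := hX j; rewrite !inE => /andP[].
    have := cross _ _ i0Y' hX'; apply/negP; rewrite -leqNgt.
    pose J := i0 |: h @: [set: 'I_s].
    have <- : #|\bigcup_(i in J) u @: P i| = s.+1 * l.
      rewrite (@card_bigcup_disjoint _ _ _ _ l).
      - rewrite cardsU1 card_imset // cardsT card_ord.
        suff -> : i0 \notin h @: [set: 'I_s] by [].
        by apply/negP => /imsetP[j _ e]; have := hX j; rewrite -e !inE eqxx.
      - by move=> i _; rewrite card_imset; [case: (Psub i)|exact: perm_inj].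
      - move=> i j _ _ ij; rewrite -setI_eq0 -imsetI; last by move=> ? ? _ _; exact: perm_inj.
        suff -> : P i :&: P j = set0 by rewrite imset0.
        apply/eqP; rewrite setI_eq0; case: (ltngtP i j) ij => [lt_ij|lt_ji|/val_inj->].
        + by move=> _; apply: Pdis; rewrite lt_ij /=.
        + by move=> _; rewrite disjoint_sym; apply: Pdis; rewrite lt_ji /=.
        + by rewrite eqxx.
    apply: subset_leq_card; apply/subsetP => x /bigcupP[i].
    rewrite !inE => /orP[/eqP->->//|/imsetP[j _ ->] xj].
    by apply/orP; right; apply/bigcupP; exists j.
  have leY := leq_trans (subset_leq_card sYX) leX.
  (* The identity [s.+1 * s + s = s * (s + 2)] dictates the choice of [t]. *)
  apply: leq_trans (leq_add (leq_mul (leqnn s.+1) leY) leX) _.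
  by rewrite /t; nia.
have t_gt0 : 0 < t by rewrite muln_gt0 s_gt0 addn_gt0 orbT.
set N := #|[set u : {perm T} | perm_on W u]|.
have N_gt0 : 0 < N by apply/card_gt0P; exists 1%g; rewrite inE perm_on1.
have total (Z : {set {set T}}) : (forall A, A \in Z -> A \subset W /\ #|A| = l) ->
    (\sum_(u : {perm T} | perm_on W u) hits u Z) * 'C(#|W|, l) = t * #|Z| * N.
  move=> ZP; rewrite exchange_big big_distrl /= -mulnA -[t in RHS]card_ord -sum_nat_const.
  apply: eq_bigr => i _; have [PW cP] := Psub i (ltn_ord i).
  by rewrite -cP sum_perm_on_imset // => A; rewrite cP; apply: ZP.
rewrite -(leq_pmul2r N_gt0) -(leq_pmul2l t_gt0).
have -> : t * ((s.+1 * #|Y| + #|X|) * N)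
    = (\sum_(u : {perm T} | perm_on W u) (s.+1 * hits u Y + hits u X)) * 'C(#|W|, l).
  rewrite big_split /= -big_distrr /= [RHS]mulnDl -[s.+1 * _ * _]mulnA !total //.
    by clearbody t; rewrite mulnDl mulnDr !mulnA [t * s.+1]mulnC.
  by move=> A /(subsetP YX); apply: XP.
rewrite mulnCA [leqRHS]mulnC leq_mul2r; apply/orP; right.
rewrite mulnC /N -sum1dep_card big_distrl /=; apply: leq_sum => u uW.
by rewrite mul1n local.
Qed.

(** * The bound for shifted families and the theorem *)

Lemma shifted_family_bound (n k s : nat) (F : {set {set 'I_n.+2}}) :
  0 < s -> s * (s + 2) * k <= n ->
  (forall A, A \in F -> #|A| = k.+1) -> shifted_on [set: 'I_n.+2] F ->
  unions_lt s.+1 (s.+1 * k).+2 F -> #|F| <= 'C(n.+1, k).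
Proof.
move=> s_gt0 n_large Fk Fsh FU.
pose a : 'I_n.+2 := ord0; pose b : 'I_n.+2 := lift ord0 ord0.
have ab : a != b by [].
pose W := ~: [set a; b].
have cW : #|W| = n by have := cardsC [set a; b]; rewrite cards2 ab card_ord -/W; lia.
have subW (A : {set _}) : (A \subset W) = (a \notin A) && (b \notin A).
  by rewrite /W subsetC subUset !sub1set !in_setC.
have WP (x : 'I_n.+2) : x \in W -> 1 < x by case: x => [[|[|x]] ltx]; rewrite !inE.
(* [D], [Y], [X] and [Z] are the traces on [W] of the members containing neither point, only [b],
   only [a], and both. *)
pose Fna := [set A in F | a \notin A].
pose X := [set A in link a F | b \notin A].
pose Z := link b (link a F).
pose D := [set A in Fna | b \notin A].
pose Y := link b Fna.
have cF : #|F| = (#|D| + #|Y|) + (#|X| + #|Z|).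
  by rewrite (card_link a F) (card_link b Fna) (card_link b (link a F)).
have nW (A : {set _}) y : A \subset W -> y \notin W -> y \notin A.
  by move=> AW; apply: contra; apply: (subsetP AW).
have aW : a \notin W by rewrite !inE eqxx.
have bW : b \notin W by rewrite !inE eqxx orbT.
have XP A : (A \in X) = (A \subset W) && (a |: A \in F).
  apply/setIdP/andP => [[/imsetP[B + ->]]|[AW aF]].
    rewrite inE => /andP[BF aB] nb; rewrite setD1K //; split=> //.
    by rewrite subW nb !inE eqxx.
  split; last exact: nW bW.
  apply/imsetP; exists (a |: A); first by rewrite !inE eqxx aF.
  by rewrite setU1K // nW.
have YP A : (A \in Y) = (A \subset W) && (b |: A \in F).
  apply/imsetP/andP => [[B + ->]|[AW bF]].
    rewrite !inE => /andP[/andP[BF aB] bB]; rewrite setD1K //; split=> //.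
    by rewrite subW !inE eqxx (negPf aB) andbF.
  exists (b |: A); last by rewrite setU1K // nW.
  by rewrite !inE eqxx bF (negPf ab) /= nW.
have DP A : (A \in D) = (A \subset W) && (A \in F).
  by rewrite !inE subW -andbA andbC.
have YX : Y \subset X.
  apply/subsetP => A; rewrite XP YP => /andP[AW bF]; rewrite AW /=.
  have -> : a |: A = replace a b (b |: A) by rewrite /replace setU1K // nW.
  apply: (Fsh a b (b |: A)) => //; rewrite ?inE ?eqxx //.
  by rewrite (negPf ab) nW.
have XW A : A \in X -> A \subset W /\ #|A| = k.
  rewrite XP => /andP[AW /Fk]; rewrite cardsU1 nW // add1n => -[].
  by [].
(* Every [x] in [W] exceeds [b], so replacing [x] by [b] in [A] gives the member [b |: (A :\ x)]. *)
have shD : shadow D \subset Y.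
  apply/subsetP => _ /imset2P[A x + xA ->]; rewrite DP YP => /andP[AW AF].
  rewrite (subset_trans (subsetDl _ _) AW) /=.
  apply: (Fsh b x A) => //; last exact: nW bW.
  exact: WP (subsetP AW _ xA).
have leD : #|D| <= s * #|Y|.
  apply: leq_trans (_ : s * #|shadow D| <= _); last first.
    by rewrite leq_mul2l subset_leq_card ?orbT.
  apply: (@leq_card_shadow _ W s k.+1).
  - by move=> A; rewrite DP => /andP[].
  - by move=> A; rewrite DP => /andP[_ /Fk].
  - move=> i j A iW jW ij; rewrite !DP => /andP[AW AF] jA iA.
    rewrite Fsh // ?inE // andbT subUset sub1set iW /=.
    exact: subset_trans (subsetDl _ _) AW.
  (* Since [s] is positive, [(s.+1 * k).+2 <= s.+1 * k.+1]. *)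
  - move=> G GD; apply: leq_trans (FU G _) _.
      by move=> i; have := GD i; rewrite DP => /andP[].
    by rewrite mulnS; lia.
have leXY : s.+1 * #|Y| + #|X| <= 'C(n, k).
  suff : s.+1 * #|Y| + #|X| <= 'C(#|W|, k) by rewrite cW.
  apply: cross_dependent_bound => //; first by rewrite cW.
  move=> A G; rewrite YP => /andP[AW bF] GX.
  have GXP i : (G i \subset W) && (a |: G i \in F) by rewrite -XP.
  (* The union of [b |: A] and the [a |: G j] is [U] together with [a] and [b], which account for
     the [.+2] in the cutoff. The point [a] occurs because [s] is positive. *)
  pose H (i : 'I_s.+1) := if unlift ord0 i is Some j then a |: G j else b |: A.
  have HF i : H i \in F.
    by rewrite /H; case: unliftP => [j _|_] //; case/andP: (GXP j).
  have := FU H HF; set U := A :|: _.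
  have UW : U \subset W.
    by rewrite subUset AW; apply/bigcupsP => i _; case/andP: (GXP i).
  have sub : a |: (b |: U) \subset \bigcup_i H i.
    rewrite !subUset !sub1set; apply/and4P; split.
    - apply/bigcupP; exists (lift ord0 (Ordinal s_gt0)) => //.
      by rewrite /H liftK !inE eqxx.
    - by apply/bigcupP; exists ord0 => //; rewrite /H unlift_none !inE eqxx.
    - apply/subsetP => x xA; apply/bigcupP; exists ord0 => //.
      by rewrite /H unlift_none !inE xA orbT.
    - apply/bigcupsP => i _; apply/subsetP => x xG.
      by apply/bigcupP; exists (lift ord0 i); rewrite // /H liftK !inE xG orbT.
  have := subset_leq_card sub; rewrite !cardsU1 !inE.
  rewrite (negPf ab) -!in_setU -/U (nW U b) // (nW U a) //=.
  by move=> le1 /(leq_ltn_trans le1).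
have leZ : #|Z| + 'C(n, k) <= 'C(n.+1, k).
  have ZP A : A \in Z -> A \subset W /\ #|A|.+2 = k.+1.
    case/imsetP => B; rewrite inE => /andP[/imsetP[C]].
    rewrite inE => /andP[CF aC] -> bC ->; split.
      by rewrite subW !inE !eqxx andbF.
    have := cardsD1 a C; have := cardsD1 b (C :\ a).
    by rewrite (Fk _ CF) aC bC; lia.
  (* For [k = 0] both binomials are [1] and [Z] must be empty; otherwise Pascal's rule leaves the
     number of [(k-1)]-subsets of [W]. *)
  case: k {Fk Fsh FU XW leD leXY n_large} ZP => [|k] ZP.
    rewrite !bin0; suff -> : Z = set0 by rewrite cards0.
    by apply/setP => A; rewrite inE; apply/negP => /ZP[].
  rewrite binS addnC leq_add2l.
  suff : #|Z| <= 'C(#|W|, k) by rewrite cW.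
  rewrite -cards_draws.
  apply: subset_leq_card; apply/subsetP => A /ZP[AW [cA]].
  by rewrite inE AW cA /=.
by rewrite cF; lia.
Qed.

Theorem theorem3 (n k s : nat) (n_gt0 : 0 < n) (k_gt0 : 0 < k) (s_gt0 : 0 < s)
    (n_large : s * (s + 2) * k < n)
    (F : {set {set 'I_n}})
    (F_uniform : forall A : {set 'I_n}, A \in F -> #|A| = k)
    (F_union : forall G : 'I_s.+1 -> {set 'I_n},
       (forall i, G i \in F) -> #|\bigcup_(i < s.+1) G i| <= k + s * (k - 1)) :
  #|F| <= 'C(n - 1, k - 1).
Proof.
case: k k_gt0 n_large F_uniform F_union => // k _ n_large F_uniform F_union.
case: n n_gt0 n_large F F_uniform F_union => [|[|n]] // _ n_large F; first by nia.
have {}n_large : s * (s + 2) * k <= n.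
  have t_gt0 : 0 < s * (s + 2) by nia.
  by move: n_large; rewrite mulnS; lia.
rewrite !subn1 /= => F_uniform F_union.
have FU : unions_lt s.+1 (s.+1 * k).+2 F.
  by move=> G GF; rewrite ltnS mulSn -addSn; apply: F_union.
(* [F] is generalised together with its hypotheses, so the shift case only needs that shifting
   preserves them and the number of members. *)
move: F F_uniform FU {F_union}; apply: shifting_ind => [F Fsh Fk FU|F i j ij IH Fk FU].
  exact: shifted_family_bound FU.
rewrite -(card_shift_family F i j); apply: IH.
  by move=> _ /imsetP[A AF ->]; rewrite card_shift Fk.
by apply: unions_lt_shift => //; apply: contraTneq ij => ->; rewrite ltnn.
Qed.
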